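(* Let $S$ be a $\vee$-semilattice with minimum $0$ and let $\prec$ be a binary relation on $S$ that is distributive, auxiliary, interpolative and approximating. Then for all $p,q\in S$, \[p\leq q\qquad\Leftrightarrow\qquad\widehat{S}_p\subseteq\widehat{S}_q.\]
   Context: A $\vee$-semilattice is a poset $(S,\leq)$ with binary joins $\vee$. A filter is a non-empty $F\subseteq S$ such that for all $p,q\in S$: $p,q\in F$ iff there is $r\in F$ with $r\leq p,q$. An ideal is a non-empty $I\subseteq S$ such that for all $p,q\in S$: $p,q\in I$ iff there is $r\in I$ with $r\geq p,q$. A filter $P$ is prime if $S\setminus P$ is an ideal; proper if $P\neq S$; round if for every $p\in P$ there is $r\in P$ with $r\prec p$. $\widehat{S}$ denotes the set of all proper round prime filters of $S$, and $\widehat{S}_p=\{P\in\widehat{S}:p\in P\}$ for $p\in S$. $\prec$ is distributive if for all $p,s,t\in S$: $p\prec s\vee t$ implies that for every $p'\prec p$ there are $s'\prec s$ and $t'\prec t$ with $p'\leq s'\vee t'\leq p$. $\prec$ is auxiliary if for all $p,p',q,q'\in S$: $p\leq p'\prec q'\leq q$ implies $p\prec q$, and $p\prec q$ implies $p\leq q$. $\prec$ is interpolative if whenever $p\prec q$ there is $s\in S$ with $p\prec s\prec q$. $\prec$ is approximating if for all $p,q\in S$: $p\leq q$ iff $\{r\in S:r\prec p\}\subseteq\{r\in S:r\prec q\}$. *)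

(* Defs.v *)
From mathcomp Require Import all_boot all_order.
From mathcomp Require Import classical_sets.

Set Implicit Arguments.
Unset Strict Implicit.
Unset Printing Implicit Defensive.

Local Open Scope classical_set_scope.
Local Open Scope order_scope.

Section Definitions.
Context {d : Order.disp_t} {S : bJoinSemilatticeType d}.
Implicit Types (F I P : set S) (p q r s t : S).

Definition order_filter F : Prop :=
  F !=set0 /\
  forall p q, (F p /\ F q) <-> exists2 r, F r & (r <= p /\ r <= q).

Definition order_ideal I : Prop :=
  I !=set0 /\
  forall p q, (I p /\ I q) <-> exists2 r, I r & (p <= r /\ q <= r).

Definition prime_filter P : Prop := order_filter P /\ order_ideal (~` P).

Definition proper_subset P : Prop := P <> setT.

Variable prec : S -> S -> Prop.

Definition round P : Prop := forall p, P p -> exists2 r, P r & prec r p.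

Definition spectrum : set (set S) :=
  [set P | [/\ proper_subset P, round P & prime_filter P]].

Definition spectrum_at p : set (set S) := [set P | spectrum P /\ P p].

Definition distributive_rel : Prop :=
  forall p s t, prec p (s `|` t) ->
    forall p', prec p' p ->
      exists s' t', [/\ prec s' s, prec t' t, p' <= s' `|` t' & s' `|` t' <= p].

Definition auxiliary_rel : Prop :=
  (forall p p' q' q, p <= p' -> prec p' q' -> q' <= q -> prec p q) /\
  (forall p q, prec p q -> p <= q).

Definition interpolative_rel : Prop :=
  forall p q, prec p q -> exists2 s, prec p s & prec s q.

Definition approximating_rel : Prop :=
  forall p q, p <= q <-> [set r | prec r p] `<=` [set r | prec r q].

End Definitions.

(* Main.v *)
Require Import Defs.
From mathcomp Require Import all_boot all_order.
From mathcomp Require Import boolp classical_sets.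

(** Suppose [~ p <= q].  Approximation gives [p0] with [prec p0 p] and
    [~ prec p0 q]; interpolating repeatedly above [p0] yields a [prec]-descending
    sequence from [p] generating a round filter [F] that contains [p] but not [q].
    By Zorn's lemma pick an ideal [I] containing [q] and maximal among those
    disjoint from [F].  The complement of [I] is the required prime: maximality
    turns [~ I a] into [F (i `|` a)] for some [i] in [I], and distributivity
    applied below [i `|` a] extracts elements below [a] outside [I].  This
    shows that the complement is round and then, using roundness, that it is
    down-directed. *)

Set Implicit Arguments.
Unset Strict Implicit.
Unset Printing Implicit Defensive.

Local Open Scope classical_set_scope.
Local Open Scope order_scope.

Import Order.LTheory.

Section Semilattice.
Context {d : Order.disp_t} {S : bJoinSemilatticeType d}.
Implicit Types (F I : set S) (a p q x y : S).

Lemma order_filter_le F x y : order_filter F -> F x -> x <= y -> F y.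
Proof. by move=> [_ hF] Fx xy; have [_ []] := hF y y; first by exists x. Qed.

Lemma order_filter_meet F x y : order_filter F -> F x -> F y ->
  exists2 r, F r & (r <= x /\ r <= y).
Proof. by move=> [_ hF] Fx Fy; apply/hF. Qed.

Lemma order_ideal_le I x y : order_ideal I -> I y -> x <= y -> I x.
Proof. by move=> [_ hI] Iy xy; have [_ []] := hI x x; first by exists y. Qed.

Lemma order_ideal_join I x y : order_ideal I -> I x -> I y -> I (x `|` y).
Proof.
move=> hI Ix Iy; have [r Ir [xr yr]] := (hI.2 x y).1 (conj Ix Iy).
by apply: order_ideal_le hI Ir _; rewrite leUx xr yr.
Qed.

Lemma order_idealI I : I !=set0 ->
  (forall x y z, I x -> I y -> z <= x `|` y -> I z) -> order_ideal I.
Proof.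
move=> I0 hI; split=> // x y; split=> [[Ix Iy]|[r Ir [xr yr]]].
  by exists (x `|` y); [exact: hI Ix Iy _ | rewrite leUl leUr].
by split; apply: (hI r r) => //; rewrite joinxx.
Qed.

Lemma order_filterI F : F !=set0 -> (forall x y, F x -> x <= y -> F y) ->
  (forall x y, F x -> F y -> exists2 r, F r & (r <= x /\ r <= y)) ->
  order_filter F.
Proof.
move=> F0 hle hmeet; split=> // x y; split=> [[]|[r Fr [rx ry]]]; first exact: hmeet.
by split; apply: hle Fr _.
Qed.

Lemma maximal_disjoint_ideal F q : order_filter F -> ~ F q ->
  exists I, [/\ order_ideal I, I q, forall x, I x -> ~ F x &
    forall a, ~ I a -> exists2 i, I i & F (i `|` a)].
Proof.
move=> hF Fq.
(* The empty set satisfies [C], as the union of the empty chain must; the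
   nonempty members of [C] are the ideals that contain [q] and avoid [F]. *)
pose C : set (set S) := [set A | forall x y z, A x -> A y ->
  z <= x `|` y `|` q -> A z /\ ~ F z].
have [A [CA maxA]] : exists A, C A /\ forall B, A `<` B -> ~ C B.
  apply: Zorn_bigcup => G GC Gtot x y z [X GX Xx] [Y GY Yy] zxy.
  have [XY|YX] := Gtot X Y GX GY.
    by have [Yz Fz] := GC Y GY x y z (XY x Xx) Yy zxy; split=> //; exists Y.
  by have [Xz Fz] := GC X GX x y z Xx (YX y Yy) zxy; split=> //; exists X.
(* If [q] is missing, [A] is empty, since [q] lies below any [x] joined with [q]; the principal
   ideal of [q] then extends [A] within [C]. *)
have Aq : A q.
  apply: contrapT => nAq.
  have A0 x : ~ A x by move=> Ax; apply: nAq; apply: (CA x x q Ax Ax _).1; exact: leUr.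
  apply: (maxA [set x | x <= q]).
    by split=> [x /A0//|/(_ q (lexx q))].
  move=> x y z /= xq yq zxy.
  have zq : z <= q by apply: le_trans zxy _; rewrite !leUx xq yq lexx.
  by split=> // Fz; apply: Fq; apply: order_filter_le hF Fz zq.
have hA : order_ideal A.
  apply: order_idealI; first by exists q.
  by move=> x y z Ax Ay zxy; apply: (CA x y z Ax Ay _).1; apply: le_trans zxy (leUl _ _).
exists A; split=> // [x Ax|a nAa]; first exact: (CA x x x Ax Ax (le_trans (leUl _ _) (leUl _ _))).2.
apply: contrapT => noF.
(* This is the ideal generated by [A] and [a]. It is strictly larger than [A], and it avoids [F]
   when no [i] in [A] satisfies [F (i]|[a)]. *)
apply: (maxA [set x | exists2 i, A i & x <= i `|` a]).
  split=> [x Ax|/(_ a)]; first by exists x => //; exact: leUl.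
  by move=> h; apply/nAa/h; exists q => //; exact: leUr.
move=> x y z [i Ai xi] [j Aj yj] zxy.
have Ak : A (i `|` j `|` q) by do ?apply: order_ideal_join.
have zk : z <= i `|` j `|` q `|` a.
  apply: le_trans zxy _; rewrite !leUx; apply/andP; split; [apply/andP; split|].
  - by apply: le_trans xi _; apply: leU2 => //; rewrite -joinA leUl.
  - by apply: le_trans yj _; apply: leU2 => //; rewrite joinAC leUr.
  - by rewrite joinAC leUr.
split; first by exists (i `|` j `|` q).
by move=> Fz; apply: noF; exists (i `|` j `|` q) => //; apply: order_filter_le hF Fz zk.
Qed.

Variable prec : S -> S -> Prop.

Lemma round_filter_above p0 p : auxiliary_rel prec -> interpolative_rel prec ->
  prec p0 p -> exists F, [/\ order_filter F, round prec F, F p &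
    forall x, F x -> prec p0 x].
Proof.
move=> [haux hle] hint p0p.
have [f hf] : {f : S -> S & forall x, prec p0 x -> prec p0 (f x) /\ prec (f x) x}.
  apply: (@choice S S (fun x y => prec p0 x -> prec p0 y /\ prec y x)) => x.
  (* The value [x] is only a default: the iterates from [p] all stay [prec]-above [p0]. *)
  have [p0x|np0x] := EM (prec p0 x); last by exists x.
  by have [y ? ?] := hint _ _ p0x; exists y.
pose s n := iter n f p.
have p0s n : prec p0 (s n) by elim: n => //= n /hf[].
have s_prec n : prec (s n.+1) (s n) by have [] := hf _ (p0s n).
have s_le m n : (m <= n)%N -> s n <= s m.
  move=> /subnK <-; elim: (n - m)%N => [|k IH]; first exact: lexx.
  by apply: le_trans IH; apply: hle; exact: s_prec.
(* The upward closure of the sequence is round because [s n.+1] is [prec]-below everything above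
   [s n]. *)
exists [set x | exists n, s n <= x]; split.
- apply: order_filterI; first by exists p, 0.
    by move=> x y [n sx] xy; exists n; apply: le_trans xy.
  move=> x y [m sx] [n sy]; exists (s (maxn m n)); first by exists (maxn m n).
  by split; [apply: le_trans sx | apply: le_trans sy]; apply: s_le;
    rewrite ?leq_maxl ?leq_maxr.
- move=> x [n sx]; exists (s n.+1); first by exists n.+1.
  exact: haux (lexx _) (s_prec n) sx.
- by exists 0.
- by move=> x [n sx]; apply: haux (lexx _) (p0s n) sx.
Qed.

Lemma compl_maximal_ideal_round_prime F I :
  distributive_rel prec -> auxiliary_rel prec ->
  order_filter F -> round prec F -> order_ideal I ->
  (forall x, I x -> ~ F x) ->
  (forall a, ~ I a -> exists2 i, I i & F (i `|` a)) ->
  round prec (~` I) /\ prime_filter (~` I).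
Proof.
move=> hdist [haux hle] hF rF hI dis maxI.
(* Roundness supplies the [f'] that distributivity requires. If [a'] were in [I], so would be
   [i']|[a'], which lies above [f'] in [F]. *)
have extract i a f : I i -> F f -> prec f (i `|` a) ->
    exists a', [/\ prec a' a, a' <= f & ~ I a'].
  move=> Ii Ff fia; have [f' Ff' f'f] := rF _ Ff.
  have [i' [a' [i'i a'a f'le lef]]] := hdist _ _ _ fia _ f'f.
  exists a'; split=> //; first by apply: le_trans lef; exact: leUr.
  move=> Ia'; apply: (dis (i' `|` a')); last exact: order_filter_le hF Ff' f'le.
  by apply: order_ideal_join => //; apply: order_ideal_le hI Ii (hle _ _ i'i).
have rnd : round prec (~` I).
  move=> a /maxI[i Ii /rF[f Ff fia]].
  by have [a' [a'a _ nIa']] := extract _ _ _ Ii Ff fia; exists a'.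
split=> //; split; last by rewrite setCK.
apply: order_filterI.
- by have [[x Fx] _] := hF; exists x => /dis.
- by move=> x y nIx xy Iy; apply: nIx; apply: order_ideal_le hI Iy xy.
move=> a b /= /maxI[i Ii Fia] /maxI[j Ij Fjb].
have [g Fg [gia gjb]] := order_filter_meet hF Fia Fjb.
have [f Ff fg] := rF _ Fg.
have fia : prec f (i `|` a) by apply: haux (lexx _) fg gia.
have [a' [a'a a'f nIa']] := extract _ _ _ Ii Ff fia.
(* The bound [a' <= f] carries the second join over to [a'], so splitting below [a'] gives a [b']
   that is under [b] and also under [a'], hence under [a]. *)
have a'jb : prec a' (j `|` b) by apply: haux a'f fg gjb.
have [a2 nIa2 a2a'] := rnd _ nIa'.
have [j' [b' [j'j b'b a2le lea']]] := hdist _ _ _ a'jb _ a2a'.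
exists b'.
  move=> Ib'; apply: nIa2; apply: order_ideal_le (hI) _ a2le.
  by apply: order_ideal_join => //; apply: order_ideal_le hI Ij (hle _ _ j'j).
split; last exact: hle.
by apply: le_trans (hle _ _ a'a); apply: le_trans lea'; exact: leUr.
Qed.

End Semilattice.

Theorem proposition2p11 (d : Order.disp_t) (S : bJoinSemilatticeType d)
    (prec : S -> S -> Prop)
    (hdistr : distributive_rel prec)
    (haux : auxiliary_rel prec)
    (hinterp : interpolative_rel prec)
    (happrox : approximating_rel prec) :
  forall p q : S,
    p <= q <-> spectrum_at prec p `<=` spectrum_at prec q.
Proof.
move=> p q; split=> [pq P [specP Pp]|sub].
  by split=> //; case: specP => _ _ [hP _]; apply: order_filter_le hP Pp pq.
apply/happrox => p0 /= p0p; apply: contrapT => np0q.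
have [F [hF rF Fp aboveF]] := round_filter_above haux hinterp p0p.
have nFq : ~ F q by move=> /aboveF.
have [I [hI Iq dis maxI]] := maximal_disjoint_ideal hF nFq.
have [rI primeI] :=
  compl_maximal_ideal_round_prime hdistr haux hF rF hI dis maxI.
(* It suffices that this prime contains [p], which lies in [F]: the inclusion then forces [q]
   outside [I], contradicting [Iq]. *)
have [] : spectrum_at prec q (~` I); last by move=> _; apply.
apply: sub; split; last by move=> /dis.
split=> // IT; have : (~` I) q by rewrite IT.
exact.
Qed.
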